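(* Let $\mathcal{X} = \mathcal{X}_1 \times \cdots \times \mathcal{X}_N$ with each $\mathcal{X}_i \subseteq \mathbb{R}^{n_i}$ nonempty, closed and convex, $\sum_{i=1}^N n_i = n$, and let $\mathcal{D} \subseteq \mathbb{R}_+^M$ be nonempty, convex and compact. Let $f(\mathbf{x}) = \frac{1}{2}\mathbf{x}^{\top}A\mathbf{x} + \mathbf{b}^{\top}\mathbf{x} + c$ with $A \in \mathbb{R}^{n\times n}$ symmetric positive semidefinite, $\mathbf{b} \in \mathbb{R}^n$, $c \in \mathbb{R}$, and let $\mathbf{g}(\mathbf{x}) = D\mathbf{x} + \mathbf{d}$ with $D \in \mathbb{R}^{M \times n}$, $\mathbf{d} \in \mathbb{R}^M$. Let $p > 0$, let $\Gamma_x \in \mathbb{R}^{n \times n}$ and $\Gamma_\lambda \in \mathbb{R}^{M \times M}$ be diagonal positive definite matrices, and define $$\mathcal{L}_p(\mathbf{x}, \boldsymbol{\lambda}) := f(\mathbf{x}) + \boldsymbol{\lambda}^{\top}\mathbf{g}(\mathbf{x}) + \frac{p}{2}\mathbf{x}^{\top}\Gamma_x^{-1}\mathbf{x} - \frac{p}{2}\boldsymbol{\lambda}^{\top}\Gamma_\lambda^{-1}\boldsymbol{\lambda}.$$ Assume the problem is distributable: writing $\mathbf{x} = (\mathbf{x}_1, \ldots, \mathbf{x}_N)$ with $\mathbf{x}_i \in \mathbb{R}^{n_i}$, for each $i$ there is a function $\mathcal{L}_{i,p}(\mathbf{x}_i, \boldsymbol{\lambda})$ such that $\nabla_{\mathbf{x}_i}\mathcal{L}_p(\mathbf{x},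 \boldsymbol{\lambda}) = \nabla_{\mathbf{x}_i}\mathcal{L}_{i,p}(\mathbf{x}_i, \boldsymbol{\lambda})$ for all $\mathbf{x}, \boldsymbol{\lambda}$. Let $\alpha_1, \ldots, \alpha_N, \alpha > 0$. For each $k$, let $\boldsymbol{\gamma}_{x,i}^{(k)} \in \mathbb{R}^{n_i}$ ($i = 1, \ldots, N$) and $\boldsymbol{\gamma}_\lambda^{(k)} \in \mathbb{R}^M$ be vectors with strictly positive entries, and let $\Gamma_{x,i}^{(k)}$ and $\Gamma_\lambda^{(k)}$ be the associated switched step-size matrices (defined in the context). Then, for each $k$, the fixed-point system $$\mathbf{x}_i = \mathrm{Proj}_{\mathcal{X}_i}\{\mathbf{x}_i - \alpha_i\, \Gamma_{x,i}^{(k)} \nabla_{\mathbf{x}_i}\mathcal{L}_{i,p}(\mathbf{x}_i, \boldsymbol{\lambda})\}, \quad i = 1, \ldots, N,$$ $$\boldsymbol{\lambda} = \mathrm{Proj}_{\mathcal{D}}\{\boldsymbol{\lambda} + \alpha\, \Gamma_\lambda^{(k)} \nabla_{\boldsymbol{\lambda}}\mathcal{L}_p(\mathbf{x}, \boldsymbol{\lambda})\}$$ has a unique solution $(\mathbf{x}, \boldsymbol{\lambda})$, the function $\mathcal{L}_p$ has a unique saddle point on $\mathcal{X} \times \mathcal{D}$ (minimization over $\mathbf{x} \in \mathcal{X}$, maximization over $\boldsymbol{\lambda} \in \mathcal{D}$), and the two coincide.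
   Context: $\mathrm{Proj}_{S}(\mathbf{z}) := \arg\min_{\mathbf{s} \in S}\|\mathbf{z} - \mathbf{s}\|_2$ is the Euclidean projection. The switched step-size matrices, evaluated at $(\mathbf{x}, \boldsymbol{\lambda})$, are: $\Gamma_{x,i}^{(k)} := \mathrm{diag}(\boldsymbol{\gamma}_{x,i}^{(k)})$ if $\mathbf{x}_i - \alpha_i\, \mathrm{diag}(\boldsymbol{\gamma}_{x,i}^{(k)})\nabla_{\mathbf{x}_i}\mathcal{L}_{i,p}(\mathbf{x}_i, \boldsymbol{\lambda}) \in \mathcal{X}_i$, and $\Gamma_{x,i}^{(k)} := I$ otherwise; $\Gamma_\lambda^{(k)} := \mathrm{diag}(\boldsymbol{\gamma}_\lambda^{(k)})$ if $\boldsymbol{\lambda} + \alpha\, \mathrm{diag}(\boldsymbol{\gamma}_\lambda^{(k)})\nabla_{\boldsymbol{\lambda}}\mathcal{L}_p(\mathbf{x}, \boldsymbol{\lambda}) \in \mathcal{D}$, and $\Gamma_\lambda^{(k)} := I$ otherwise. A saddle point of $\mathcal{L}_p$ on $\mathcal{X} \times \mathcal{D}$ is a pair $(\mathbf{x}^*, \boldsymbol{\lambda}^* ) \in \mathcal{X} \times \mathcal{D}$ with $\mathcal{L}_p(\mathbf{x}^*, \boldsymbol{\lambda}) \leq \mathcal{L}_p(\mathbf{x}^*, \boldsymbol{\lambda}^* ) \leq \mathcal{L}_p(\mathbf{x}, \boldsymbol{\lambda}^* )$ for all $\mathbf{x} \in \mathcal{X}$, $\boldsymbol{\lambda} \in \mathcal{D}$.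 *)

(* Defs.v *)
From mathcomp Require Import all_boot all_order all_algebra.
From mathcomp Require Import all_classical all_reals all_analysis.
Import Order.TTheory GRing.Theory Num.Theory.
Import numFieldNormedType.Exports.

Set Implicit Arguments.
Unset Strict Implicit.
Unset Printing Implicit Defensive.

Local Open Scope classical_set_scope.
Local Open Scope ring_scope.

(* Vectors of R^m are columns 'cV[R]_m. The product
   R^(n_1) x ... x R^(n_N) is 'cV[R]_(\sum_(i < N) n_ i), and the block x_i of x
   is [submxcol x i]. *)

Section LinearAlgebra.
Context {R : realType}.

Definition dot m (u v : 'cV[R]_m) : R := (u^T *m v) 0 0.

(* The library norm on matrices is the sup norm; projections need this one. *)
Definition norm2 m (u : 'cV[R]_m) : R := Num.sqrt (dot u u).

Definition psdmx m (A : 'M[R]_m) : Prop :=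
  A^T = A /\ forall v : 'cV[R]_m, 0 <= dot v (A *m v).

Definition pdmx m (A : 'M[R]_m) : Prop :=
  A^T = A /\ forall v : 'cV[R]_m, v != 0 -> 0 < dot v (A *m v).

Definition diagc m (v : 'cV[R]_m) : 'M[R]_m := diag_mx v^T.

Definition grad m (f : 'cV[R]_m -> R) (x : 'cV[R]_m) : 'cV[R]_m :=
  \col_j 'D_(delta_mx j 0) f x.

Definition argmin_dist m (S : set 'cV[R]_m) (z : 'cV[R]_m) : set 'cV[R]_m :=
  [set s | S s /\ forall t, S t -> norm2 (z - s) <= norm2 (z - t)].

(* The value 0 is a default, used only when the minimum is not attained; it is
   attained, at a unique point, when S is nonempty, closed and convex. *)
Definition Proj m (S : set 'cV[R]_m) (z : 'cV[R]_m) : 'cV[R]_m :=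
  xget 0 (argmin_dist S z).

End LinearAlgebra.

Section Problem.
Context {R : realType} {N M : nat} {n_ : 'I_N -> nat}.
Local Notation n := (\sum_(i < N) n_ i)%N.

Definition prodset (X : forall i, set 'cV[R]_(n_ i)) : set 'cV[R]_n :=
  [set x | forall i, X i (submxcol x i)].

Definition objective (A : 'M[R]_n) (b : 'cV[R]_n) (c : R) (x : 'cV[R]_n) : R :=
  2^-1 * dot x (A *m x) + dot b x + c.

Definition constraint (D : 'M[R]_(M, n)) (d : 'cV[R]_M) (x : 'cV[R]_n) :
  'cV[R]_M := D *m x + d.

Definition Lagr (f : 'cV[R]_n -> R) (g : 'cV[R]_n -> 'cV[R]_M) (p : R)
    (Gx : 'M[R]_n) (Gl : 'M[R]_M) (x : 'cV[R]_n) (l : 'cV[R]_M) : R :=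
  f x + dot l (g x) + p / 2 * dot x (invmx Gx *m x)
  - p / 2 * dot l (invmx Gl *m l).

Implicit Types (L : 'cV[R]_n -> 'cV[R]_M -> R)
  (Li : forall i, 'cV[R]_(n_ i) -> 'cV[R]_M -> R).

(* 'D_v f x is a total operator, so the existence of the gradient of Li in its
   first argument is stated explicitly. *)
Definition distributable L Li : Prop :=
  forall i,
    (forall y l, differentiable (Li i ^~ l) y) /\
    (forall x l, submxcol (grad (L ^~ l) x) i =
                 grad (Li i ^~ l) (submxcol x i)).

Definition Gamma_x Li (X : forall i, set 'cV[R]_(n_ i)) (alpha_ : 'I_N -> R)
    (gx : forall i, 'cV[R]_(n_ i)) (x : 'cV[R]_n) (l : 'cV[R]_M) (i : 'I_N) :
  'M[R]_(n_ i) :=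
  if submxcol x i
       - alpha_ i *: (diagc (gx i) *m grad (Li i ^~ l) (submxcol x i)) \in X i
  then diagc (gx i) else 1%:M.

Definition Gamma_l L (DD : set 'cV[R]_M) (alpha : R) (gl : 'cV[R]_M)
    (x : 'cV[R]_n) (l : 'cV[R]_M) : 'M[R]_M :=
  if l + alpha *: (diagc gl *m grad (L x) l) \in DD then diagc gl else 1%:M.

Definition fixed_point L Li (X : forall i, set 'cV[R]_(n_ i))
    (DD : set 'cV[R]_M) (alpha_ : 'I_N -> R) (alpha : R)
    (gx : forall i, 'cV[R]_(n_ i)) (gl : 'cV[R]_M)
    (z : 'cV[R]_n * 'cV[R]_M) : Prop :=
  let: (x, l) := z in
  (forall i, submxcol x i =
     Proj (X i) (submxcol x i
       - alpha_ i *: (Gamma_x Li X alpha_ gx x l i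
                        *m grad (Li i ^~ l) (submxcol x i)))) /\
  l = Proj DD (l + alpha *: (Gamma_l L DD alpha gl x l *m grad (L x) l)).

Definition saddle_point L (X : set 'cV[R]_n) (DD : set 'cV[R]_M)
    (z : 'cV[R]_n * 'cV[R]_M) : Prop :=
  let: (xs, ls) := z in
  [/\ X xs, DD ls &
      forall x l, X x -> DD l -> L xs l <= L xs ls /\ L xs ls <= L x ls].

End Problem.

(* Main.v *)
(* Both the fixed points and the saddle points are the solutions of one
   variational inequality, 0 <= <F z, z' - z> for all z' in K := X x D, with the
   affine operator F := (grad_x L, - grad_l L). For the saddle points this is
   first-order optimality, L being a convex quadratic in x and a concave one in
   l. For the fixed points with step matrix I it is the obtuse-angle
   characterization of projections; a step with matrix diag(gamma) is taken only
   if its endpoint stays in the set, and then either condition forces the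
   gradient to vanish. The cross terms +-D cancel in <F z - F w, z - w>, so the
   regularization makes F strongly monotone: this gives uniqueness, and for small
   t the map z |-> Proj_K (z - t F z) is a Euclidean contraction, whose fixed
   point solves the variational inequality. *)

From HB Require Import structures.
Require Import Defs.
From mathcomp Require Import all_boot all_order all_algebra.
From mathcomp Require Import all_classical all_reals all_analysis.
From mathcomp Require Import ring lra.
Import Order.TTheory GRing.Theory Num.Theory.
Import numFieldNormedType.Exports.

Set Implicit Arguments.
Unset Strict Implicit.
Unset Printing Implicit Defensive.

Local Open Scope classical_set_scope.
Local Open Scope ring_scope.

(* The join of the complete and the normed module structures, both already
   present on matrices. *)
HB.instance Definition _ (R : realType) m n := NormedModule.on (matrix R m n).

(** * Euclidean inner product, and its comparison with the sup norm *)

Section Dot.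
Context {R : realType}.

Lemma dotE m (u v : 'cV[R]_m) : dot u v = \sum_i u i 0 * v i 0.
Proof. by rewrite /dot mxE; apply: eq_bigr => i _; rewrite mxE. Qed.

Lemma dotC m (u v : 'cV[R]_m) : dot u v = dot v u.
Proof. by rewrite !dotE; apply: eq_bigr => i _; rewrite mulrC. Qed.

Lemma dotDl m (u v w : 'cV[R]_m) : dot (u + v) w = dot u w + dot v w.
Proof. by rewrite /dot linearD mulmxDl mxE. Qed.

Lemma dotDr m (u v w : 'cV[R]_m) : dot u (v + w) = dot u v + dot u w.
Proof. by rewrite /dot mulmxDr mxE. Qed.

Lemma dot0l m (v : 'cV[R]_m) : dot 0 v = 0.
Proof. by rewrite /dot trmx0 mul0mx mxE. Qed.

Lemma dot0r m (u : 'cV[R]_m) : dot u 0 = 0.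
Proof. by rewrite dotC dot0l. Qed.

Lemma dotNl m (u v : 'cV[R]_m) : dot (- u) v = - dot u v.
Proof. by rewrite /dot linearN mulNmx mxE. Qed.

Lemma dotNr m (u v : 'cV[R]_m) : dot u (- v) = - dot u v.
Proof. by rewrite /dot mulmxN mxE. Qed.

Lemma dotZl m (a : R) (u v : 'cV[R]_m) : dot (a *: u) v = a * dot u v.
Proof. by rewrite /dot linearZ -scalemxAl mxE. Qed.

Lemma dotZr m (a : R) (u v : 'cV[R]_m) : dot u (a *: v) = a * dot u v.
Proof. by rewrite /dot -scalemxAr mxE. Qed.

Lemma dot_mull m k (B : 'M[R]_(m, k)) (u : 'cV[R]_k) (v : 'cV[R]_m) :
  dot (B *m u) v = dot u (B^T *m v).
Proof. by rewrite /dot trmx_mul mulmxA. Qed.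

Definition dot_linear := (dotDl, dotDr, dotNl, dotNr, dotZl, dotZr).

Lemma dot_delta m (u : 'cV[R]_m) j : dot u (delta_mx j 0) = u j 0.
Proof.
rewrite dotE (bigD1 j) //= mxE !eqxx mulr1 big1 ?addr0 // => i /negbTE ij.
by rewrite mxE ij mulr0.
Qed.

Lemma dot_ge0 m (u : 'cV[R]_m) : 0 <= dot u u.
Proof. by rewrite dotE sumr_ge0 // => i _; rewrite -expr2 sqr_ge0. Qed.

Lemma sqr_coord_le_dot m (u : 'cV[R]_m) i : u i 0 ^+ 2 <= dot u u.
Proof.
rewrite dotE (bigD1 i) //= -expr2 lerDl sumr_ge0 // => j _.
by rewrite -expr2 sqr_ge0.
Qed.

Lemma dot_le0_eq0 m (u : 'cV[R]_m) : dot u u <= 0 -> u = 0.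
Proof.
move=> u0; apply/colP => i; rewrite mxE; apply/eqP; rewrite -sqrf_eq0 eq_le.
by rewrite sqr_ge0 (le_trans (sqr_coord_le_dot u i)).
Qed.

(** The form is the sum of the terms [g j 0 * u j 0 ^+ 2], all nonnegative, so each of them must
    vanish. *)
Lemma dot_diagc_gt0 m (g u : 'cV[R]_m) :
  (forall i, 0 < g i 0) -> dot u (diagc g *m u) <= 0 -> u = 0.
Proof.
move=> g0; rewrite dotE => le0; apply/colP => i; rewrite mxE.
have E j : u j 0 * (diagc g *m u) j 0 = g j 0 * u j 0 ^+ 2.
  by rewrite /diagc mul_diag_mx !mxE expr2; ring.
have nn j : 0 <= g j 0 * u j 0 ^+ 2 by rewrite mulr_ge0 ?sqr_ge0 // ltW.
move: le0; under eq_bigr do rewrite E.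
rewrite (bigD1 i) //= => le0; apply/eqP; rewrite -sqrf_eq0.
have : g i 0 * u i 0 ^+ 2 <= 0.
  by apply: le_trans le0; rewrite lerDl sumr_ge0.
by rewrite pmulr_rle0 // => le; rewrite eq_le le sqr_ge0.
Qed.

Lemma le_norm2 m (u v : 'cV[R]_m) : (norm2 u <= norm2 v) = (dot u u <= dot v v).
Proof. by rewrite ler_sqrt ?dot_ge0. Qed.

Lemma sqr_norm_le_dot m (u : 'cV[R]_m) : `|u| ^+ 2 <= dot u u.
Proof.
have [u0|/mx_norm_neq0[[i j] /= E]] := eqVneq (mx_norm u) 0.
  by rewrite [`|u|]u0 expr0n /= dot_ge0.
by rewrite [`|u|]E -normrX ger0_norm ?sqr_ge0 // ord1 sqr_coord_le_dot.
Qed.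

Lemma dot_le_sqr_norm m (u : 'cV[R]_m) : dot u u <= m%:R * `|u| ^+ 2.
Proof.
have le i : u i 0 * u i 0 <= `|u| ^+ 2.
  rewrite -expr2 -(ger0_norm (sqr_ge0 (u i 0))) normrX lerXn2r ?nnegrE //.
  by rewrite [`|u|]mx_normrE; apply/bigmax_geP; right; exists (i, 0).
rewrite dotE (le_trans (ler_sum _ (fun i _ => le i))) //.
by rewrite sumr_const card_ord mulr_natl.
Qed.

Lemma dot_submxcol N (n_ : 'I_N -> nat) (u v : 'cV[R]_(\sum_(i < N) n_ i)) :
  dot u v = \sum_i dot (submxcol u i) (submxcol v i).
Proof.
rewrite -[in LHS](submxcolK u) -[in LHS](submxcolK v) /dot tr_mxcol.
by rewrite mul_mxrow_mxcol summxE.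
Qed.

Lemma dot_col_mx m k (u u' : 'cV[R]_m) (v v' : 'cV[R]_k) :
  dot (col_mx u v) (col_mx u' v') = dot u u' + dot v v'.
Proof. by rewrite /dot tr_col_mx mul_row_col mxE. Qed.

End Dot.

(** * Continuity by coordinates, and compactness for column vectors *)

Section Topology.
Context {R : realType}.

Lemma continuous_coords (T : topologicalType) m k (f : T -> 'M[R]_(m, k)) :
  (forall i j, continuous (fun x => f x i j)) -> continuous f.
Proof.
move=> fc x A [P PA PsubA]; apply: (filterS (fun y => PsubA (f y))).
apply: filter_forall => i; apply: filter_forall => j.
exact: fc (PA i j).
Qed.

Lemma trmx_continuous m k : continuous (@trmx R m k).
Proof.
apply: continuous_coords => i j.
rewrite [X in continuous X](_ : _ = fun x : 'M[R]_(m, k) => x j i).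
  exact: coord_continuous.
by apply/funext => x; rewrite mxE.
Qed.

Lemma submxcol_continuous N (n_ : 'I_N -> nat) i :
  continuous (fun x : 'cV[R]_(\sum_(i < N) n_ i) => submxcol x i).
Proof.
apply: continuous_coords => j k.
rewrite [X in continuous X](_ : _ =
    fun x : 'cV[R]_(\sum_(i < N) n_ i) => x (tagnat.Rank i j) k).
  exact: coord_continuous.
by apply/funext => x; rewrite mxE.
Qed.

Lemma usubmx_continuous m k : continuous (fun z : 'cV[R]_(m + k) => usubmx z).
Proof.
apply: continuous_coords => i j.
rewrite [X in continuous X](_ : _ = fun x : 'cV[R]_(m + k) => x (lshift k i) j).
  exact: coord_continuous.
by apply/funext => x; rewrite mxE.
Qed.

Lemma dsubmx_continuous m k : continuous (fun z : 'cV[R]_(m + k) => dsubmx z).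
Proof.
apply: continuous_coords => i j.
rewrite [X in continuous X](_ : _ = fun x : 'cV[R]_(m + k) => x (rshift m i) j).
  exact: coord_continuous.
by apply/funext => x; rewrite mxE.
Qed.

(** Heine-Borel is carried over from row vectors by transposition, which is continuous and does not
    increase the sup norm. *)
Lemma cV_bounded_closed_compact m (S : set 'cV[R]_m) :
  bounded_set S -> closed S -> compact S.
Proof.
move=> [B [Breal BS]] clS.
have -> : S = trmx @` (trmx @^-1` S : set 'rV[R]_m).
  apply/seteqP; split => [x Sx|_ [y Sy <-]] //.
  by exists x^T; rewrite /= ?trmxK.
apply: continuous_compact.
  by apply: continuous_subspaceT; exact: trmx_continuous.
apply: bounded_closed_compact; last first.
  move/continuous_closedP: (@trmx_continuous 1 m); exact.
exists B; split=> // b Bb y /(BS b Bb) /=; apply: le_trans.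
rewrite [leLHS]mx_normrE [leRHS]mx_normrE.
apply/bigmax_leP; split; first exact: bigmax_ge_id.
move=> [i j] _ /=; apply/bigmax_geP; right; exists (j, i) => //=.
by rewrite mxE.
Qed.

Lemma continuous_dot (T : topologicalType) m (f : T -> 'cV[R]_m) :
  (forall i, continuous (fun x => f x i 0)) ->
  continuous (fun x => dot (f x) (f x)).
Proof.
move=> fc; rewrite [X in continuous X](_ : _ =
    \sum_i (fun x => f x i 0 * f x i 0)); last first.
  by apply/funext => s; rewrite dotE fct_sumE.
apply: (big_ind (fun h : T -> R => continuous h)) => [|g h gc hc x|i _ x].
- exact: (@cst_continuous _ _ (0 : R)).
- by apply: cvgD; [exact: gc|exact: hc].
- by apply: cvgM; exact: fc.
Qed.

Lemma sqdist_continuous m (z : 'cV[R]_m) :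
  continuous (fun s => dot (z - s) (z - s)).
Proof.
apply: continuous_dot => i.
rewrite [X in continuous X](_ : _ =
    (fun a => z i 0 - a) \o (fun s : 'cV[R]_m => s i 0)).
  move=> s; apply: continuous_comp; first exact: coord_continuous.
  by apply: cvgB; [exact: cvg_cst|exact: cvg_id].
by apply/funext => s; rewrite /= !mxE.
Qed.

End Topology.

(** * Euclidean projections and variational inequalities *)

Section Projection.
Context {R : realType}.

Lemma convex_set_segment m (S : set 'cV[R]_m) (s t : 'cV[R]_m) (h : R) :
  convex_set S -> S s -> S t -> 0 <= h -> h <= 1 -> S (s + h *: (t - s)).
Proof.
move=> Scvx Ss St h0 h1.
have -> : s + h *: (t - s) = h *: t + (1 - h) *: s.
  by rewrite scalerBr scalerBl scale1r addrCA.
exact: set_mem (Scvx t s (@Itv01 R h h0 h1) (mem_set St) (mem_set Ss)).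
Qed.

Lemma argmin_dist_neq0 m (S : set 'cV[R]_m) (z : 'cV[R]_m) :
  S !=set0 -> closed S -> argmin_dist S z !=set0.
Proof.
move=> [s0 Ss0] Scl; pose r := dot (z - s0) (z - s0).
(* Points farther from [z] than [s0] cannot be minimizers, so the search is confined to a compact
   piece of [S]. *)
pose S' := S `&` [set s | dot (z - s) (z - s) <= r].
have cl : closed S'.
  apply: closedI => //.
  rewrite [X in closed X](_ : _ =
    (fun s => dot (z - s) (z - s)) @^-1` [set x | x <= r]) //.
  move/continuous_closedP: (@sqdist_continuous R m z); apply.
  exact: closed_le.
have bd : bounded_set S'.
  (* The square of the sup norm of [z - s] is at most [r], hence the norm itself is at most [1 + r];
     this avoids a square root. *)
  exists (`|z| + (1 + r)); split; first exact: num_real.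
  move=> b bb s [Ss sr]; apply/ltW/(le_lt_trans _ bb).
  rewrite -[s](subKr z) (le_trans (ler_normB _ _)) // lerD2l.
  have r0 : 0 <= r := dot_ge0 _.
  have : `|z - s| ^+ 2 <= r := le_trans (sqr_norm_le_dot _) sr.
  have := normr_ge0 (z - s).
  nra.
have [||s] := compact_EVT_min (f := fun s => dot (z - s) (z - s)) (A := S') _
    (cV_bounded_closed_compact bd cl).
- by exists s0; split => //=.
- by apply: continuous_subspaceT; exact: sqdist_continuous.
rewrite inE => -[Ss sr] smin; exists s; split => // t St; rewrite le_norm2.
have [tr|/ltW rt] := leP (dot (z - t) (z - t)) r.
  by apply: smin; rewrite inE.
exact: le_trans rt.
Qed.

(** The first-order test: for small [h] the linear term dominates. It turns minimality along a
    segment into a sign condition on the derivative. *)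
Lemma quadratic_ge0 (a q : R) :
  (forall h, 0 < h -> h <= 1 -> 0 <= h * a + h ^+ 2 * q) -> 0 <= a.
Proof.
move=> H; have [//|a0] := leP 0 a.
have e0 : 0 < `|q| - a by rewrite subr_gt0 (lt_le_trans a0).
(* With this [h], the sum [a + h * |q|] equals [h * a], which is negative when [a] is. *)
pose h := - a / (`|q| - a).
have hE : h * (`|q| - a) = - a by rewrite /h divfK // gt_eqF.
have h0 : 0 < h by rewrite divr_gt0 ?oppr_gt0.
have h1 : h <= 1 by rewrite ler_pdivrMr // mul1r lerDr.
have := H h h0 h1; rewrite expr2 -mulrA -mulrDr pmulr_rge0 //.
have : h * q <= h * `|q| by rewrite ler_pM2l // ler_norm.
have : h * a < 0 by rewrite pmulr_rlt0.
lra.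
Qed.

Definition vi_solution m (S : set 'cV[R]_m) (F : 'cV[R]_m -> 'cV[R]_m) s :=
  S s /\ forall t, S t -> 0 <= dot (F s) (t - s).

Section ClosedConvex.
Context {m : nat} {S : set 'cV[R]_m}.
Hypotheses (S_neq0 : S !=set0) (S_closed : closed S) (S_cvx : convex_set S).

Lemma Proj_mem z : S (Proj S z).
Proof. by have [] := xgetPex 0 (argmin_dist_neq0 z S_neq0 S_closed). Qed.

(** The squared distance to [z] along the segment from the projection to [t] is quadratic in the
    parameter and minimal at its start, so its initial slope is nonnegative. *)
Lemma Proj_obtuse z t : S t -> dot (z - Proj S z) (t - Proj S z) <= 0.
Proof.
move=> St; set s := Proj S z.
have [_ smin] := xgetPex 0 (argmin_dist_neq0 z S_neq0 S_closed).
suff : 0 <= - (2 * dot (z - s) (t - s)) by lra.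
apply: (@quadratic_ge0 _ (dot (t - s) (t - s))) => h /ltW h0 h1.
have := smin _ (convex_set_segment S_cvx (Proj_mem z) St h0 h1).
rewrite le_norm2 -/(Proj S z) -/s opprD addrA.
rewrite [dot (_ - _ - _) _](_ : _ =
  dot (z - s) (z - s) + (h * - (2 * dot (z - s) (t - s)) +
    h ^+ 2 * dot (t - s) (t - s))) ?lerDl //.
move: (z - s) (t - s) => u v.
by rewrite !dot_linear (dotC v u); ring.
Qed.

(** For the converse, the obtuse-angle inequalities at [s] and at the projection, each tested
    against the other point, add up to a nonpositive squared distance. *)
Lemma Proj_eqP z s :
  s = Proj S z <-> S s /\ forall t, S t -> dot (z - s) (t - s) <= 0.
Proof.
split=> [->|[Ss sP]]; first by split; [exact: Proj_mem|exact: Proj_obtuse].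
apply/subr0_eq/dot_le0_eq0.
have := sP _ (Proj_mem z); have := Proj_obtuse z Ss; move: (Proj S z) => p.
rewrite !dot_linear (dotC z s) (dotC z p) (dotC p s); lra.
Qed.

(** With [p], [q] the projections of [u], [v], the two obtuse-angle inequalities give [dot (p - q)
    (p - q) <= dot (u - v) (p - q)]; expanding the square of [(u - v) - (p - q)] finishes. *)
Lemma Proj_nonexpansive u v :
  dot (Proj S u - Proj S v) (Proj S u - Proj S v) <= dot (u - v) (u - v).
Proof.
have := Proj_obtuse u (Proj_mem v); have := Proj_obtuse v (Proj_mem u).
move: (Proj S u) (Proj S v) => p q.
have := dot_ge0 ((u - v) - (p - q)).
rewrite !dot_linear (dotC v u) (dotC p u) (dotC q u) (dotC p v) (dotC q v).
rewrite (dotC q p); lra.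
Qed.

Lemma Proj_viP (F : 'cV[R]_m -> 'cV[R]_m) (a : R) s : 0 < a ->
  s = Proj S (s - a *: F s) <-> vi_solution S F s.
Proof.
move=> a0; rewrite Proj_eqP; split=> -[Ss sP]; split=> // t /sP;
  by rewrite [s - _ - s]addrC addKr dotNl dotZl oppr_le0 pmulr_rge0.
Qed.

(* If the scaled step stays in S, testing the inequality against its endpoint
   forces the gradient to vanish. *)
Lemma switched_Proj_viP (F : 'cV[R]_m -> 'cV[R]_m) (a : R) (g s : 'cV[R]_m) :
  0 < a -> (forall j, 0 < g j 0) ->
  s = Proj S (s - a *: ((if s - a *: (diagc g *m F s) \in S
                         then diagc g else 1%:M) *m F s)) <->
  vi_solution S F s.
Proof.
move=> a0 g0; case: ifPn => [/set_mem inS|_]; last first.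
  by rewrite mul1mx; exact: Proj_viP.
split=> [/(Proj_eqP _ _)[Ss sP]|[Ss sP]].
  split=> // t St.
  suff -> : F s = 0 by rewrite dot0l.
  apply: (dot_diagc_gt0 g0).
  have := sP _ inS.
  rewrite [s - _ - s]addrC addKr dotNl dotNr opprK dotZl dotZr.
  move=> le0; have w0 : diagc g *m F s = 0.
    by apply: dot_le0_eq0; move: le0; rewrite !pmulr_rle0.
  by rewrite w0 dot0r.
have F0 : F s = 0.
  apply: (dot_diagc_gt0 g0).
  have := sP _ inS.
  by rewrite [s - _ - s]addrC addKr dotNr dotZr oppr_ge0 pmulr_rle0.
apply/Proj_eqP; split => // t St.
by rewrite F0 mulmx0 scaler0 subr0 subrr dot0l.
Qed.

End ClosedConvex.

(** A crude bound suffices: each entry of [w] is at most [norm2 w], so row [i] of the product is at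
    most its absolute row sum [c i] times [norm2 w]. *)
Lemma mulmx_dot_bound m (H : 'M[R]_m) :
  exists2 C, 0 <= C & forall w, dot (H *m w) (H *m w) <= C * dot w w.
Proof.
pose c i := \sum_j `|H i j|.
exists (\sum_i c i ^+ 2) => [|w].
  by rewrite sumr_ge0 // => i _; rewrite sqr_ge0.
rewrite dotE mulr_suml ler_sum // => i _.
have le j : `|w j 0| <= norm2 w.
  by rewrite -sqrtr_sqr ler_sqrt ?dot_ge0 // sqr_coord_le_dot.
rewrite -expr2 -(sqr_sqrtr (dot_ge0 w)) -/(norm2 w) -exprMn.
rewrite -real_normK ?num_real // lerXn2r ?nnegrE //.
  by rewrite mulr_ge0 ?sqrtr_ge0 // sumr_ge0.
rewrite mxE (le_trans (ler_norm_sum _ _ _)) // mulr_suml ler_sum // => j _.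
by rewrite normrM ler_wpM2l.
Qed.

(** * Strongly monotone affine variational inequalities *)

Section MonotoneVI.
Context {m : nat} {K : set 'cV[R]_m} {H : 'M[R]_m} {h : 'cV[R]_m} {mu : R}.
Hypotheses (K_neq0 : K !=set0) (K_closed : closed K) (K_cvx : convex_set K).
Hypotheses (mu_gt0 : 0 < mu)
  (H_mono : forall v, mu * dot v v <= dot v (H *m v)).
Let F z := H *m z + h.

(** Testing each solution against the other and adding gives [dot (F z - F w) (z - w) <= 0], against
    strong monotonicity. *)
Lemma vi_unique z w : vi_solution K F z -> vi_solution K F w -> z = w.
Proof.
move=> [Kz zP] [Kw wP]; apply/subr0_eq/dot_le0_eq0.
rewrite -(pmulr_rle0 _ mu_gt0) (le_trans (H_mono _)) //.
rewrite mulmxBr; have := zP _ Kw; have := wP _ Kz; rewrite /F.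
move: (H *m z) (H *m w) => a b.
rewrite !dot_linear (dotC z a) (dotC z b) (dotC w a) (dotC w b); lra.
Qed.

Lemma vi_exists : exists z, vi_solution K F z.
Proof.
have [C C0 HC] := mulmx_dot_bound H.
have D0 : 0 < C + mu ^+ 2 by rewrite ltr_wpDl ?exprn_gt0.
(* A step [t] changes the squared distance by a factor of at most [1 - 2 * t * mu + t ^+ 2 * C].
   This [t] gives [t * C <= mu], so the factor is at most [q]; the summand [mu ^+ 2] keeps the
   denominator positive and [q] nonnegative. *)
pose t := mu / (C + mu ^+ 2); pose q := 1 - t * mu.
have t0 : 0 < t by rewrite divr_gt0.
have tE : t * (C + mu ^+ 2) = mu by rewrite /t divfK ?gt_eqF.
have q0 : 0 <= q.
  rewrite subr_ge0 /t mulrAC ler_pdivrMr // mul1r -expr2.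
  by rewrite lerDr.
have q1 : q < 1 by rewrite gtrDl oppr_lt0 mulr_gt0.
pose T z := Proj K (z - t *: F z).
have Tq z w : dot (T z - T w) (T z - T w) <= q * dot (z - w) (z - w).
  apply: le_trans (Proj_nonexpansive K_neq0 K_closed K_cvx _ _) _.
  rewrite [X in dot X X](_ : _ = (z - w) - t *: (H *m (z - w))); last first.
    rewrite /F mulmxBr !scalerDr !scalerN; apply/colP => i; rewrite !mxE; ring.
  move: (z - w) => v; have := HC v; have := H_mono v.
  rewrite !dot_linear (dotC _ v); set d := dot v (H *m v).
  set e := dot (H *m v) (H *m v); set n := dot v v => le1 le2.
  have n0 : 0 <= n by exact: dot_ge0.
  have le1' : t * (mu * n) <= t * d by rewrite ler_pM2l.
  have le2' : t * (t * e) <= t * (t * (C * n)) by rewrite !ler_pM2l.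
  have tC : t * (t * (C * n)) <= t * (mu * n).
    rewrite ler_pM2l // mulrA ler_wpM2r // -tE ler_pM2l // lerDl.
    exact: sqr_ge0.
  rewrite /q; lra.
have iterq k z w : dot (iter k T z - iter k T w) (iter k T z - iter k T w)
    <= q ^+ k * dot (z - w) (z - w).
  elim: k => [|k IH] /=; first by rewrite mul1r.
  by rewrite (le_trans (Tq _ _)) // exprS -mulrA ler_wpM2l.
(* The factor absorbs the constant [m] of the norm comparison; the successor covers [m = 0] and also
   yields [q ^+ k < 1]. *)
have [k kq] : exists k, q ^+ k * m.+1%:R < 1.
  have /cvg_expr/cvgrPdist_lt : `|q| < 1 by rewrite ger0_norm.
  have M0 : (0 : R) < m.+1%:R^-1 by rewrite invr_gt0.
  move=> /(_ _ M0) [k _ /(_ k (leqnn k))].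
  rewrite sub0r normrN ger0_norm ?exprn_ge0 // => lt; exists k.
  by rewrite -ltr_pdivlMr // mul1r.
have m1 : (1 : R) <= m.+1%:R by rewrite ler1n.
have qk0 : 0 <= q ^+ k by rewrite exprn_ge0.
(* T contracts the Euclidean norm but not the library (sup) norm; an iterate of
   T contracts the latter, the two norms being equivalent. *)
have [z _ zE] : exists2 z, setT z & z = iter k T z.
  have hom : {homo iter k T : x / setT x >-> setT x} by [].
  apply: (@banach_fixed_point _ _ setT (mkfun hom)); last 2 first.
  - exact: closedT.
  - by exists 0.
  (* The estimates concern squared norms, so the Lipschitz constant is a square root. *)
  exists (NngNum (sqrtr_ge0 (q ^+ k * m.+1%:R))); split => /=.
    by rewrite -[ltRHS]sqrtr1 ltr_sqrt.
  move=> [z w] _ /=.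
  rewrite -(ler_pXn2r (ltn0Sn 1)) ?nnegrE ?mulr_ge0 ?sqrtr_ge0 //.
  rewrite exprMn sqr_sqrtr ?mulr_ge0 //.
  apply: le_trans (sqr_norm_le_dot _) (le_trans (iterq _ _ _) _).
  rewrite -mulrA ler_wpM2l // (le_trans (dot_le_sqr_norm _)) //.
  by rewrite ler_wpM2r ?sqr_ge0 // ler_nat.
(* [T z] is also fixed by the iterate, which contracts Euclidean distances, so it equals [z]. *)
have TzE : T z = z.
  apply/subr0_eq/dot_le0_eq0; have := iterq k (T z) z.
  rewrite -iterSr iterS -zE.
  have : q ^+ k < 1 by apply: le_lt_trans kq; rewrite ler_peMr.
  have := dot_ge0 (T z - z); set n := dot _ _; nra.
by exists z; apply/(Proj_viP K_neq0 K_closed K_cvx F z t0).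
Qed.

End MonotoneVI.

End Projection.

(** * Gradients and minimizers of quadratic functions *)

Section Quadratic.
Context {R : realType}.

(** The difference quotient is exactly [a + h * q] for nonzero [h]. *)
Lemma derive_quadratic (V : normedModType R) (f : V -> R) (x v : V) (a q : R) :
  (forall h, f (h *: v + x) = f x + h * a + h ^+ 2 * q) -> 'D_v f x = a.
Proof.
move=> fE; apply: cvg_lim => //.
have : (a + h * q) @[h --> (0 : R)^'] --> a + 0 * q.
  apply: cvgD; first exact: cvg_cst.
  by apply: cvgM; [exact: (@nbhs_dnbhs R 0)|exact: cvg_cst].
rewrite mul0r addr0.
apply: cvg_trans; apply: near_eq_cvg.
near=> h.
have h0 : h != 0 by near: h; exact: nbhs_dnbhs_neq.
rewrite /= fE /GRing.scale /=; field.
exact: h0.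
Unshelve. all: by end_near. Qed.

Lemma grad_quadratic m (f : 'cV[R]_m -> R) (Q : 'M[R]_m) (g x : 'cV[R]_m) :
  (forall v, f (x + v) = f x + dot g v + dot v (Q *m v)) -> grad f x = g.
Proof.
move=> fE; apply/colP => j; rewrite mxE -dot_delta.
apply: (@derive_quadratic _ _ _ _ _ (dot (delta_mx j 0) (Q *m delta_mx j 0))).
by move=> h; rewrite addrC fE -scalemxAr !dot_linear; ring.
Qed.

(** Sufficiency drops the nonnegative second-order term of the exact expansion; necessity expands
    along segments of [S] and applies [quadratic_ge0]. *)
Lemma quadratic_minP m (S : set 'cV[R]_m) (f : 'cV[R]_m -> R) (Q : 'M[R]_m)
    (g x : 'cV[R]_m) :
  convex_set S -> S x ->
  (forall v, f (x + v) = f x + dot g v + dot v (Q *m v)) ->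
  (forall v, 0 <= dot v (Q *m v)) ->
  (forall y, S y -> 0 <= dot g (y - x)) <-> (forall y, S y -> f x <= f y).
Proof.
move=> Scvx Sx fE Q0; split=> [xP y Sy|xmin y Sy].
  by rewrite -[y](subrKC x) fE -addrA lerDl addr_ge0 // xP.
apply: (@quadratic_ge0 _ _ (dot (y - x) (Q *m (y - x)))) => h /ltW h0 h1.
have := xmin _ (convex_set_segment Scvx Sx Sy h0 h1).
rewrite fE -scalemxAr !dotZl !dotZr -addrA lerDl.
by rewrite expr2 -mulrA.
Qed.

(** An upper bound on the positive diagonal entries of [G] is a lower bound on those of its
    inverse. *)
Lemma pd_diag_inv_ge m (G : 'M[R]_m) : is_diag_mx G -> pdmx G ->
  exists2 mu, 0 < mu & forall v, mu * dot v v <= dot v (invmx G *m v).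
Proof.
move=> /diag_mxP[D ->] [_ Gpd].
have D0 i : 0 < D 0 i.
  have /Gpd : delta_mx i 0 != 0 :> 'cV[R]_m.
    apply/eqP => /colP/(_ i); rewrite !mxE !eqxx /= => /eqP.
    by rewrite oner_eq0.
  by rewrite dotC dot_delta mul_diag_mx !mxE !eqxx mulr1.
(* The trace bounds every diagonal entry; the added 1 keeps [s] positive in dimension 0. *)
pose s := 1 + \sum_i D 0 i.
have Ds i : D 0 i <= s.
  rewrite /s (bigD1 i) //= addrCA lerDl addr_ge0 // sumr_ge0 // => j _.
  exact: ltW.
have s0 : 0 < s.
  by rewrite ltr_wpDr // sumr_ge0 // => i _; exact: ltW.
exists s^-1 => [|v]; first by rewrite invr_gt0.
have GV : diag_mx D *m diag_mx (map_mx GRing.inv D) = 1%:M.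
  rewrite mulmx_diag -diag_const_mx; congr diag_mx.
  by apply/rowP => i; rewrite !mxE mulfV // gt_eqF.
have -> : invmx (diag_mx D) = diag_mx (map_mx GRing.inv D).
  have [uG _] := mulmx1_unit GV.
  by rewrite -[RHS](mulKmx uG) GV mulmx1.
rewrite !dotE mulr_sumr ler_sum // => i _.
rewrite mul_diag_mx !mxE [leRHS]mulrCA ler_wpM2r -?expr2 ?sqr_ge0 //.
by rewrite lef_pV2 ?posrE.
Qed.

End Quadratic.

(** * Convex sets, products, and variational inequalities on products *)

Section Convexity.
Context {R : realType}.

Lemma convex_set_preimage m k (f : 'cV[R]_m -> 'cV[R]_k) (S : set 'cV[R]_k) :
  (forall a b u v, f (a *: u + b *: v) = a *: f u + b *: f v) ->
  convex_set S -> convex_set (f @^-1` S : set 'cV[R]_m).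
Proof.
move=> flin Scvx x y t /set_mem Sx /set_mem Sy; apply/mem_set.
change (S (f (t%:num *: x + (1 - t%:num) *: y))); rewrite flin.
exact: set_mem (Scvx (f x) (f y) t (mem_set Sx) (mem_set Sy)).
Qed.

Lemma convex_setI m (S T : set 'cV[R]_m) :
  convex_set S -> convex_set T -> convex_set (S `&` T).
Proof.
move=> Sc Tc x y t /set_mem[Sx Tx] /set_mem[Sy Ty]; apply/mem_set; split.
  exact/set_mem/(Sc x y t (mem_set Sx) (mem_set Sy)).
exact/set_mem/(Tc x y t (mem_set Tx) (mem_set Ty)).
Qed.

End Convexity.

Section Products.
Context {R : realType}.

Lemma prodset_bigcap N (n_ : 'I_N -> nat) (X : forall i, set 'cV[R]_(n_ i)) :
  prodset X = \bigcap_i ((fun x => submxcol x i) @^-1` X i).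
Proof. by apply/seteqP; split => [x Xx i _|x Xx i]; [exact: Xx|exact: Xx]. Qed.

Lemma prodset_neq0 N (n_ : 'I_N -> nat) (X : forall i, set 'cV[R]_(n_ i)) :
  (forall i, X i !=set0) -> prodset X !=set0.
Proof.
move=> X0; exists (\mxcol_i projT1 (cid (X0 i))) => i.
by rewrite mxcolK; case: cid.
Qed.

Lemma prodset_closed N (n_ : 'I_N -> nat) (X : forall i, set 'cV[R]_(n_ i)) :
  (forall i, closed (X i)) -> closed (prodset X).
Proof.
move=> Xcl; rewrite prodset_bigcap; apply: closed_bigI => i _.
by move/continuous_closedP: (@submxcol_continuous R N n_ i); apply.
Qed.

Lemma prodset_convex N (n_ : 'I_N -> nat) (X : forall i, set 'cV[R]_(n_ i)) :
  (forall i, convex_set (X i)) -> convex_set (prodset X).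
Proof.
move=> Xcvx x y t /set_mem Xx /set_mem Xy; apply/mem_set => i.
have lin (a b : R) (u v : 'cV_(\sum_(i < N) n_ i)) :
    submxcol (a *: u + b *: v) i = a *: submxcol u i + b *: submxcol v i.
  by apply/matrixP => j k; rewrite !mxE.
have := convex_set_preimage lin (Xcvx i).
move=> /(_ x y t (mem_set (Xx i)) (mem_set (Xy i))).
exact: set_mem.
Qed.

(** The inner product is a sum over blocks. Replacing only block [i] of [x] by [t] kills all other
    terms and isolates the inequality on [X i]; conversely the block inequalities add up. *)
Lemma vi_prodsetP N (n_ : 'I_N -> nat) (X : forall i, set 'cV[R]_(n_ i))
    (F : 'cV[R]_(\sum_(i < N) n_ i) -> 'cV[R]_(\sum_(i < N) n_ i))
    (Fi : forall i, 'cV[R]_(n_ i) -> 'cV[R]_(n_ i)) x :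
  (forall i, submxcol (F x) i = Fi i (submxcol x i)) ->
  vi_solution (prodset X) F x <->
  forall i, vi_solution (X i) (Fi i) (submxcol x i).
Proof.
move=> FE; split=> [[Xx xP] i|xP].
  split=> [|t Xt]; first exact: Xx.
  pose yi j := @eqtype.dfwith _ (fun j => 'cV[R]_(n_ j)) (submxcol x) i t j.
  pose y := \mxcol_j yi j; have yE j : submxcol y j = yi j by rewrite mxcolK.
  have /xP : prodset X y.
    move=> j; rewrite yE /yi.
    by case: eqtype.dfwithP => [|k _]; [exact: Xt|exact: Xx].
  rewrite dot_submxcol (bigD1 i) //= [X in _ + X]big1 => [|j ji].
    by rewrite addr0 FE submxcolB yE /yi dfwith_in.
  by rewrite submxcolB yE /yi dfwith_out 1?eq_sym // subrr dot0r.
split=> [i|y Xy]; first by have [] := xP i.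
rewrite dot_submxcol sumr_ge0 // => i _.
by rewrite FE submxcolB; have [_] := xP i; apply; exact: Xy.
Qed.

(** Test points that keep one component fixed isolate the other. The equation on [F] is asked only
    at the point itself, so [f] may be a gradient at frozen [l] and [g] one at frozen [x]. *)
Lemma vi_col_mxP m k (S : set 'cV[R]_m) (T : set 'cV[R]_k)
    (F : 'cV[R]_(m + k) -> 'cV[R]_(m + k)) (f : 'cV[R]_m -> 'cV[R]_m)
    (g : 'cV[R]_k -> 'cV[R]_k) x l :
  F (col_mx x l) = col_mx (f x) (g l) ->
  vi_solution ((fun z => usubmx z) @^-1` S `&` (fun z => dsubmx z) @^-1` T)
    F (col_mx x l) <->
  vi_solution S f x /\ vi_solution T g l.
Proof.
have dist y t : dot (col_mx (f x) (g l)) (col_mx y t - col_mx x l) =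
    dot (f x) (y - x) + dot (g l) (t - l).
  by rewrite opp_col_mx add_col_mx dot_col_mx.
move=> FE; rewrite /vi_solution FE /= col_mxKu col_mxKd.
split=> [[[Sx Tl] xlP]|[[Sx xP] [Tl lP]]].
  split; split=> // y Sy.
    have := xlP (col_mx y l).
    rewrite col_mxKu col_mxKd dist => /(_ (conj Sy Tl)).
    by rewrite [l - l]subrr dot0r addr0.
  have := xlP (col_mx x y); rewrite col_mxKu col_mxKd dist => /(_ (conj Sx Sy)).
  by rewrite [x - x]subrr dot0r add0r.
split=> // z [Sz Tz]; rewrite -[z]vsubmxK dist addr_ge0 //.
  exact: xP.
exact: lP.
Qed.

End Products.

(** * Exact expansion of quadratic functions *)

Section Lagrangian.
Context {R : realType} {n M : nat}.

(** The common shape of the Lagrangian in [x] and in [l], in any dimension, so that one expansion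
    serves both. *)
Definition quadratic_fun (A : 'M[R]_n) (b : 'cV[R]_n) (c : R)
    (x : 'cV[R]_n) : R :=
  2^-1 * dot x (A *m x) + dot b x + c.

Lemma quadratic_funD (A : 'M[R]_n) (b : 'cV[R]_n) (c : R) (x v : 'cV[R]_n) :
  A^T = A ->
  quadratic_fun A b c (x + v) =
  quadratic_fun A b c x + dot (A *m x + b) v + dot v ((2^-1 *: A) *m v).
Proof.
move=> AT; rewrite /quadratic_fun mulmxDr -scalemxAl !dot_linear.
rewrite (dot_mull A x v) AT.
rewrite (_ : dot v (A *m x) = dot x (A *m v)); last by rewrite dotC dot_mull AT.
by field.
Qed.

End Lagrangian.

(** * The regularized Lagrangian and its saddle operator *)

Section SaddlePoint.
Context {R : realType} {N M : nat} {n_ : 'I_N -> nat}.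
Local Notation n := (\sum_(i < N) n_ i)%N.
Variables (A : 'M[R]_n) (b : 'cV[R]_n) (c : R).
Variables (D : 'M[R]_(M, n)) (d : 'cV[R]_M).
Variables (p : R) (Gx : 'M[R]_n) (Gl : 'M[R]_M).
Hypotheses (A_psd : psdmx A) (p_gt0 : 0 < p).
Hypotheses (Gx_diag : is_diag_mx Gx) (Gx_pd : pdmx Gx).
Hypotheses (Gl_diag : is_diag_mx Gl) (Gl_pd : pdmx Gl).
Let L := Lagr (objective A b c) (constraint D d) p Gx Gl.

(** [Qx] is the Hessian of [L] in [x], and [Ql] is minus its Hessian in [l]. *)
Let Qx := A + p *: invmx Gx.
Let Ql := p *: invmx Gl.
Let gradx x l := Qx *m x + (b + D^T *m l).
Let gradl x l := - (Ql *m l) + (D *m x + d).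

Lemma Qx_sym : Qx^T = Qx.
Proof. by rewrite linearD linearZ /= trmx_inv A_psd.1 Gx_pd.1. Qed.

Lemma Ql_sym : Ql^T = Ql.
Proof. by rewrite linearZ /= trmx_inv Gl_pd.1. Qed.

Lemma Lagr_expandx l x v :
  L (x + v) l = L x l + dot (gradx x l) v + dot v ((2^-1 *: Qx) *m v).
Proof.
have LE y : L y l = quadratic_fun Qx (b + D^T *m l) (c + dot l d
    - p / 2 * dot l (invmx Gl *m l)) y.
  rewrite /L /Lagr /objective /constraint /quadratic_fun /Qx mulmxDl.
  rewrite -scalemxAl.
  by rewrite !dot_linear dot_mull trmxK; field.
by rewrite !LE quadratic_funD ?Qx_sym.
Qed.

Lemma Lagr_expandl x l v :
  L x (l + v) = L x l + dot (gradl x l) v + dot v ((- (2^-1 *: Ql)) *m v).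
Proof.
have LE y : L x y = quadratic_fun (- Ql) (D *m x + d) (objective A b c x
    + p / 2 * dot x (invmx Gx *m x)) y.
  rewrite /L /Lagr /constraint /quadratic_fun /Ql mulNmx -scalemxAl.
  by rewrite !dot_linear (dotC _ y) (dotC _ y); field.
have Ql_symN : (- Ql)^T = - Ql by rewrite linearN /= Ql_sym.
by rewrite !LE quadratic_funD // scalerN mulNmx.
Qed.

Lemma grad_Lagrx x l : grad (L ^~ l) x = gradx x l.
Proof. exact: grad_quadratic (Lagr_expandx l x). Qed.

Lemma grad_Lagrl x l : grad (L x) l = gradl x l.
Proof. exact: grad_quadratic (Lagr_expandl x l). Qed.

(** The linear part of the saddle operator. The second block row is negated because [l] is
    maximized, which makes the off-diagonal part skew-symmetric. *)
Let H := block_mx Qx D^T (- D) Ql.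
Let F z := H *m z + col_mx b (- d).

Lemma saddle_operatorE x l :
  F (col_mx x l) = col_mx (grad (L ^~ l) x) (- grad (L x) l).
Proof.
rewrite /F mul_block_col add_col_mx grad_Lagrx grad_Lagrl /gradx /gradl.
congr col_mx; first by rewrite addrAC addrA.
by rewrite !opprD opprK mulNmx addrA [- _ + _ in LHS]addrC.
Qed.

(** The skew part cancels in the quadratic form and [A] contributes a nonnegative term, so the two
    regularization terms give the modulus. *)
Lemma saddle_operator_mono :
  exists2 mu, 0 < mu & forall z, mu * dot z z <= dot z (H *m z).
Proof.
have [m1 m10 H1] := pd_diag_inv_ge Gx_diag Gx_pd.
have [m2 m20 H2] := pd_diag_inv_ge Gl_diag Gl_pd.
exists (p * Num.min m1 m2); first by rewrite mulr_gt0 // lt_min m10.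
move=> z; rewrite -[z]vsubmxK; move: (usubmx z) (dsubmx z) => x l.
rewrite /H mul_block_col !dot_col_mx /Qx /Ql mulmxDl -!scalemxAl mulNmx.
rewrite !dot_linear.
have -> : dot x (D^T *m l) = dot l (D *m x) by rewrite dotC dot_mull trmxK.
have xA := A_psd.2 x.
have xG : p * (Num.min m1 m2 * dot x x) <= p * dot x (invmx Gx *m x).
  rewrite ler_pM2l // (le_trans _ (H1 x)) // ler_wpM2r ?dot_ge0 //.
  by rewrite ge_min lexx.
have lG : p * (Num.min m1 m2 * dot l l) <= p * dot l (invmx Gl *m l).
  rewrite ler_pM2l // (le_trans _ (H2 l)) // ler_wpM2r ?dot_ge0 //.
  by rewrite ge_min lexx orbT.
lra.
Qed.

Lemma Qx_ge0 v : 0 <= dot v ((2^-1 *: Qx) *m v).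
Proof.
have [mu mu0 Hmu] := pd_diag_inv_ge Gx_diag Gx_pd.
rewrite -scalemxAl dotZr mulr_ge0 ?invr_ge0 // mulmxDl -scalemxAl dotDr dotZr.
rewrite addr_ge0 ?(A_psd.2 v) // mulr_ge0 ?(ltW p_gt0) //.
by rewrite (le_trans _ (Hmu v)) // mulr_ge0 ?dot_ge0 // ltW.
Qed.

Lemma Ql_ge0 v : 0 <= dot v ((2^-1 *: Ql) *m v).
Proof.
have [mu mu0 Hmu] := pd_diag_inv_ge Gl_diag Gl_pd.
rewrite -!scalemxAl !dotZr !mulr_ge0 ?invr_ge0 ?(ltW p_gt0) //.
by rewrite (le_trans _ (Hmu v)) // mulr_ge0 ?dot_ge0 // ltW.
Qed.

(** Freezing one variable splits the saddle condition into the minimization of [L] in [x] and of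
    [- L] in [l], both convex quadratics. *)
Lemma saddle_viP (X : set 'cV[R]_n) (DD : set 'cV[R]_M) x l :
  convex_set X -> convex_set DD ->
  saddle_point L X DD (x, l) <->
  vi_solution X (fun x => grad (L ^~ l) x) x /\
  vi_solution DD (fun l => - grad (L x) l) l.
Proof.
move=> Xcvx Dcvx; rewrite /vi_solution grad_Lagrx grad_Lagrl.
have xP (Xx : X x) :=
  quadratic_minP (f := L ^~ l) Xcvx Xx (Lagr_expandx l x) Qx_ge0.
have negL v : - L x (l + v) =
    - L x l + dot (- gradl x l) v + dot v ((2^-1 *: Ql) *m v).
  by rewrite Lagr_expandl mulNmx dotNr dotNl; ring.
have lP (Dl : DD l) :=
  quadratic_minP (f := fun l => - L x l) Dcvx Dl negL Ql_ge0.
split=> [[Xx Dl xl]|[[Xx xv] [Dl lv]]].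
  split; split=> //.
    by apply/(xP Xx) => y Xy; have [] := xl y l Xy Dl.
  by apply/(lP Dl) => m Dm; rewrite lerN2; have [] := xl x m Xx Dm.
split=> // y m Xy Dm; split; last exact: (xP Xx).1 xv y Xy.
by rewrite -lerN2; exact: (lP Dl).1 lv m Dm.
Qed.

Lemma saddle_vi_exists_unique (X : set 'cV[R]_n) (DD : set 'cV[R]_M) :
  X !=set0 -> closed X -> convex_set X ->
  DD !=set0 -> closed DD -> convex_set DD ->
  exists! z, vi_solution X (fun x => grad (L ^~ z.2) x) z.1 /\
             vi_solution DD (fun l => - grad (L z.1) l) z.2.
Proof.
move=> [x0 Xx0] Xcl Xcvx [l0 Dl0] Dcl Dcvx.
pose K := (fun z : 'cV[R]_(n + M) => usubmx z) @^-1` X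
          `&` (fun z : 'cV[R]_(n + M) => dsubmx z) @^-1` DD.
have K0 : K !=set0.
  by exists (col_mx x0 l0); split; rewrite /= ?col_mxKu ?col_mxKd.
have Kcl : closed K.
  apply: closedI.
    by move/continuous_closedP: (@usubmx_continuous R n M); apply.
  by move/continuous_closedP: (@dsubmx_continuous R n M); apply.
have Kcvx : convex_set K.
  apply: convex_setI; apply: convex_set_preimage => // a a' u v;
    by apply/matrixP => i j; rewrite !mxE.
have [mu mu0 mono] := saddle_operator_mono.
have viP x l := vi_col_mxP X DD
  (f := fun x => grad (L ^~ l) x) (g := fun l => - grad (L x) l)
  (saddle_operatorE x l).
have [z zP] := vi_exists (h := col_mx b (- d)) K0 Kcl Kcvx mu0 mono.
exists (usubmx z, dsubmx z); split=> [|[y m]] /=.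
  by apply/viP; rewrite vsubmxK.
by move=> /viP/(vi_unique mu0 mono zP) ->; rewrite col_mxKu col_mxKd.
Qed.

End SaddlePoint.

(** * Fixed points and saddle points identified through [sol] *)

Theorem proposition3 (R : realType) (N M : nat) (n_ : 'I_N -> nat)
  (X : forall i : 'I_N, set 'cV[R]_(n_ i))
  (X_neq0 : forall i, X i !=set0)
  (X_closed : forall i, closed (X i))
  (X_convex : forall i, convex_set (X i))
  (DD : set 'cV[R]_M)
  (DD_ge0 : forall l, DD l -> forall j, 0 <= l j 0)
  (DD_neq0 : DD !=set0)
  (DD_convex : convex_set DD)
  (DD_compact : compact DD)
  (A : 'M[R]_(\sum_(i < N) n_ i)) (b : 'cV[R]_(\sum_(i < N) n_ i)) (c : R)
  (A_psd : psdmx A)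
  (D : 'M[R]_(M, \sum_(i < N) n_ i)) (d : 'cV[R]_M)
  (p : R) (p_gt0 : 0 < p)
  (Gx : 'M[R]_(\sum_(i < N) n_ i)) (Gl : 'M[R]_M)
  (Gx_diag : is_diag_mx Gx) (Gx_pd : pdmx Gx)
  (Gl_diag : is_diag_mx Gl) (Gl_pd : pdmx Gl)
  (Lp := Lagr (objective A b c) (constraint D d) p Gx Gl)
  (Lip : forall i : 'I_N, 'cV[R]_(n_ i) -> 'cV[R]_M -> R)
  (Lp_distr : distributable Lp Lip)
  (alpha_ : 'I_N -> R) (alpha_gt0 : forall i, 0 < alpha_ i)
  (alpha : R) (alpha_gt0_dual : 0 < alpha)
  (gx : nat -> forall i : 'I_N, 'cV[R]_(n_ i))
  (gx_gt0 : forall k i j, 0 < gx k i j 0)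
  (gl : nat -> 'cV[R]_M)
  (gl_gt0 : forall k j, 0 < gl k j 0) :
  forall k : nat,
    [/\ exists! z, fixed_point Lp Lip X DD alpha_ alpha (gx k) (gl k) z,
        exists! z, saddle_point Lp (prodset X) DD z &
        forall z w, fixed_point Lp Lip X DD alpha_ alpha (gx k) (gl k) z ->
                    saddle_point Lp (prodset X) DD w -> z = w].
Proof.
move=> k.
have DD_closed : closed DD by apply: compact_closed.
have Xcvx := prodset_convex X_convex.
pose sol (z : 'cV[R]_(\sum_(i < N) n_ i) * 'cV[R]_M) :=
  vi_solution (prodset X) (fun x => grad (Lp ^~ z.2) x) z.1 /\
  vi_solution DD (fun l => - grad (Lp z.1) l) z.2.
have saddleP z : saddle_point Lp (prodset X) DD z <-> sol z.
  by case: z => x l; exact: saddle_viP.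
have fixP z : fixed_point Lp Lip X DD alpha_ alpha (gx k) (gl k) z <-> sol z.
  case: z => x l; rewrite /fixed_point /sol /=.
  (* Distributability makes block [i] of the gradient a function of [x_i] alone once [l] is frozen,
     so the primal inequality splits into one per block. *)
  have prodP := @vi_prodsetP R N n_ X (fun y => grad (Lp ^~ l) y)
    (fun i y => grad (Lip i ^~ l) y) x (fun i => (Lp_distr i).2 x l).
  have primal i := switched_Proj_viP (X_neq0 i) (X_closed i) (X_convex i)
    (fun y => grad (Lip i ^~ l) y) (submxcol x i) (alpha_gt0 i) (gx_gt0 k i).
  (* Dual ascent is descent along the negated gradient; the rewriting below cancels the double
     signs. *)
  have dual := switched_Proj_viP DD_neq0 DD_closed DD_convex
    (fun m => - grad (Lp x) m) l alpha_gt0_dual (gl_gt0 k).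
  rewrite !mulmxN !scalerN !opprK in dual.
  split=> [[xP lP]|[xP lP]]; split.
  - by apply/prodP => i; apply/primal; exact: xP.
  - exact/dual.
  - by move=> i; apply/primal; apply: prodP.1.
  - exact/dual.
have [z [zP zU]] := saddle_vi_exists_unique b c D d A_psd p_gt0 Gx_diag Gx_pd
  Gl_diag Gl_pd (prodset_neq0 X_neq0) (prodset_closed X_closed) Xcvx
  DD_neq0 DD_closed DD_convex.
split.
- by exists z; split=> [|w /fixP]; [exact/fixP|exact: zU].
- by exists z; split=> [|w /saddleP]; [exact/saddleP|exact: zU].
- by move=> u w /fixP/zU <- /saddleP/zU.
Qed.
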